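(* \[ \limsup_{n\to \infty} \frac{\phi(\phi^*(n))}{n}= \limsup_{n\to\infty} \frac{\phi^*(\phi(n))}{n}= \limsup_{n\to\infty} \frac{\phi^*(\phi^*(n))}{n}=1. \]
   Context: $\phi(n)$ is Euler's totient function. $\phi^*$ is the unitary Euler function: the multiplicative function with $\phi^*(1)=1$ and, if $n=p_1^{a_1}\cdots p_r^{a_r}$ is the prime factorization of $n>1$, $\phi^*(n)=(p_1^{a_1}-1)\cdots(p_r^{a_r}-1)$. *)

(* Defs.v *)
From mathcomp Require Import all_boot all_order all_algebra.
From mathcomp Require Import all_classical all_reals all_analysis.

Set Implicit Arguments.
Unset Strict Implicit.
Unset Printing Implicit Defensive.

(* The unitary Euler function.  [primes n] is the duplicate-free list of prime
   divisors of n and [p ^ logn p n] the exact power of p dividing n; the empty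
   product gives the value 1 at n = 1.  The value 1 at n = 0 is a convention. *)
Definition unitary_totient (n : nat) : nat :=
  \prod_(p <- primes n) (p ^ logn p n - 1).

(* Main.v *)
Require Import Defs.
From mathcomp Require Import all_boot all_order all_algebra.
From mathcomp Require Import all_classical all_reals all_analysis.
From mathcomp Require Import all_solvable zify lra ring.

(* All ratios are at most 1.  For the first and the third one, take n = 2^p with
   p prime: the prime factors of 2^p - 1 exceed p and there are o(p) of them, so
   the sum of their reciprocals tends to 0.

   For the second one, n is a product of distinct large primes p with small sum
   of 1/p, such that each prime q dividing phi(n) = \prod (p - 1) divides it to a
   high power (at least squared, and q^v large when q is small); Bernoulli's
   inequality then gives the result.  Start from all primes in (2^l, 2^(k+1)].
   While some prime q divides p - 1 for some, but too few, of the remaining p,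
   delete these p.  Each q is treated at most once, and q <= 2^k since p - 1 is
   even, so at most pi(2^k) + O(1) primes are deleted.  Thus a prime survives as
   soon as (2^k, 2^(k+1)] contains more than 2^l + O(1) primes, and a Chebyshev
   lower bound yields such k with k - l of order log k.  Chebyshev's upper bound
   then makes the sum of 1/p over the whole range of order (log k) / k. *)

Set Implicit Arguments.
Unset Strict Implicit.
Unset Printing Implicit Defensive.

(** * Products over prime divisors and upper bounds for both totients *)

Lemma prod_primes_logn n : 0 < n -> \prod_(p <- primes n) p ^ logn p n = n.
Proof.
by move=> n_gt0; rewrite [RHS]prod_prime_decomp // prime_decompE big_map.
Qed.

Lemma coprime_prod_primes p (s : seq nat) :
  prime p -> all prime s -> p \notin s -> coprime p (\prod_(q <- s) q).
Proof.
move=> p_pr ps psN; rewrite big_seq.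
apply: (big_ind (coprime p)) => [|x y|q qs]; first exact: coprimen1.
  by rewrite coprimeMr => -> ->.
rewrite prime_coprime // dvdn_prime2 ?(allP ps q) //.
by apply: contraNneq psN => ->.
Qed.

Lemma prod_primes_dvdn (s : seq nat) n :
  uniq s -> all prime s -> {in s, forall p, p %| n} -> \prod_(p <- s) p %| n.
Proof.
elim: s => [|p s IHs] /=; first by rewrite big_nil dvd1n.
move=> /andP[psN us] /andP[pp ps] dvd_s; rewrite big_cons Gauss_dvd.
  rewrite dvd_s ?mem_head //=; apply: IHs => // q qs.
  by rewrite dvd_s // inE qs orbT.
exact: coprime_prod_primes.
Qed.

Lemma expn_size_leq_prod m (s : seq nat) :
  {in s, forall p, m <= p} -> m ^ size s <= \prod_(p <- s) p.
Proof.
elim: s => [|p s IHs] le_s; first by rewrite big_nil.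
rewrite big_cons expnS leq_mul ?le_s ?mem_head ?IHs // => q qs.
by rewrite le_s // inE qs orbT.
Qed.

Lemma totient_leq n : totient n <= n.
Proof.
have [->//|n_gt0] := posnP n.
rewrite totientE // -[leqRHS]prod_primes_logn // big_seq [leqRHS]big_seq.
apply: leq_prod => p; rewrite -logn_gt0 => p_n.
by rewrite -[in leqRHS](prednK p_n) expnS leq_mul2r leq_pred orbT.
Qed.

Lemma unitary_totient_leq n : 0 < n -> unitary_totient n <= n.
Proof.
move=> n_gt0; rewrite -[leqRHS]prod_primes_logn //.
by apply: leq_prod => p _; apply: leq_subr.
Qed.

Lemma unitary_totient_gt0 n : 0 < unitary_totient n.
Proof.
rewrite /unitary_totient big_seq prodn_cond_gt0 // => p p_n.
rewrite subn_gt0 -{1}(expn0 p) ltn_exp2l ?logn_gt0 //.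
by move: p_n; rewrite mem_primes => /andP[/prime_gt1].
Qed.

(** * Counting primes in half-open intervals *)

(** Open on the left and closed on the right, so that adjacent intervals concatenate without
    overlap. *)
Definition primes_in m n := [seq p <- index_iota m.+1 n.+1 | prime p].

Lemma mem_primes_in m n p : (p \in primes_in m n) = prime p && (m < p <= n).
Proof. by rewrite mem_filter mem_index_iota. Qed.

Lemma primes_in_uniq m n : uniq (primes_in m n).
Proof. exact/filter_uniq/iota_uniq. Qed.

Lemma all_prime_primes_in m n : all prime (primes_in m n).
Proof. exact: filter_all. Qed.

Lemma primes_in_cat l m n : l <= m -> m <= n ->
  primes_in l n = primes_in l m ++ primes_in m n.
Proof.
move=> lm mn; rewrite /primes_in -filter_cat /index_iota !subSS.
have -> : n - l = (m - l) + (n - m) by lia.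
by rewrite iotaD addSn subnKC.
Qed.

Lemma size_primes_in_cat l m n : l <= m -> m <= n ->
  size (primes_in l n) = size (primes_in l m) + size (primes_in m n).
Proof. by move=> lm mn; rewrite (primes_in_cat lm mn) size_cat. Qed.

Lemma size_primes_in_leq m n : size (primes_in m n) <= n - m.
Proof.
by rewrite size_filter (leq_trans (count_size _ _)) // size_iota subSS.
Qed.

(** * Central binomial coefficients and Chebyshev's bounds *)

Lemma bin_central_gt0 m : 0 < 'C(m.*2, m).
Proof. by rewrite bin_gt0 -addnn leq_addr. Qed.

Lemma bin_central_leq m : 'C(m.*2, m) <= 4 ^ m.
Proof.
have -> : 4 ^ m = (1 + 1) ^ m.*2 by rewrite -mul2n expnM.
have lt_m : m < m.*2.+1 by rewrite ltnS -addnn leq_addr.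
rewrite expnDn (bigD1 (Ordinal lt_m)) //= !exp1n !muln1.
exact: leq_addr.
Qed.

(** Below the middle, the ratio of consecutive coefficients shows that they increase; above it,
    symmetry applies. *)
Lemma leq_bin_central n i : 'C(n.*2, i) <= 'C(n.*2, n).
Proof.
have half d : 'C(n.*2, n - d) <= 'C(n.*2, n).
  elim: d => [|d IHd]; first by rewrite subn0.
  have [le_nd|lt_dn] := leqP n d.
    by move: IHd; have [-> ->] : n - d.+1 = 0 /\ n - d = 0 by lia.
  apply: leq_trans IHd; have -> : n - d = (n - d.+1).+1 by lia.
  rewrite -(@leq_pmul2l (n - d.+1).+1) // mul_bin_left leq_mul2r.
  by apply/orP; right; lia.
have [le_in|lt_ni] := leqP i n; first by rewrite -(subKn le_in) half.
have [lt_i|le_i] := ltnP n.*2 i; first by rewrite bin_small.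
rewrite -bin_sub //; have -> : n.*2 - i = n - (i - n) by lia.
exact: half.
Qed.

Lemma leq_exp4_bin_central m : 4 ^ m <= m.*2.+1 * 'C(m.*2, m).
Proof.
have -> : 4 ^ m = (1 + 1) ^ m.*2 by rewrite -mul2n expnM.
rewrite expnDn -[m.*2.+1 in leqRHS]card_ord -sum_nat_const.
by apply: leq_sum => i _; rewrite !exp1n !muln1 leq_bin_central.
Qed.

Lemma logn_bin_central p m : prime p -> 0 < m ->
  p ^ logn p 'C(m.*2, m) <= m.*2.
Proof.
move=> p_pr m_gt0; have m2_gt0 : 0 < m.*2 by rewrite double_gt0.
apply: (leq_trans _ (trunc_logP (prime_gt1 p_pr) m2_gt0)).
rewrite leq_exp2l ?prime_gt1 //; set L := trunc_log p m.*2.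
have := @bin_fact m.*2 m; rewrite -{1}addnn leq_addr => /(_ isT).
rewrite -{2}addnn addnK => /(congr1 (logn p)).
rewrite !lognM ?bin_central_gt0 ?muln_gt0 ?fact_gt0 // !logn_fact // => E.
(* Legendre's formula: each difference floor(2m/p^i) - 2 floor(m/p^i) is at most 1,
   and it vanishes for p^i > 2m. *)
have EL : forall k, k <= m.*2 -> \sum_(1 <= i < k.+1) m.*2 %/ p ^ i <=
  \sum_(1 <= i < k.+1) (m %/ p ^ i + m %/ p ^ i) + minn k L.
  elim=> [|k IHk] lt_k; first by rewrite !big_geq.
  rewrite big_nat_recr //= [in leqRHS]big_nat_recr //=.
  have {IHk} := IHk (ltnW lt_k).
  set a := \sum_(_ <= _ < _) _; set b := \sum_(_ <= _ < _) _.
  have [le_kL|lt_Lk] := leqP k.+1 L.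
    have pk_gt0 : 0 < p ^ k.+1 by rewrite expn_gt0 prime_gt0.
    have : m.*2 %/ p ^ k.+1 <= m %/ p ^ k.+1 + m %/ p ^ k.+1 + 1.
      rewrite -ltnS ltn_divLR //.
      have := ltn_ceil m pk_gt0; nia.
    lia.
  rewrite (@divn_small m.*2); first by move: (m %/ _) => x; lia.
  by rewrite (leq_trans (trunc_log_ltn _ (prime_gt1 p_pr))) ?leq_exp2l ?prime_gt1.
have := EL _ (leqnn _); rewrite big_split /=.
(* Legendre's sum for [m.*2]! has m more terms than the one for [m]!; these extra quotients vanish
   because p^i > i > m. *)
have sE : \sum_(1 <= k < m.*2.+1) m %/ p ^ k = \sum_(1 <= k < m.+1) m %/ p ^ k.
  rewrite [LHS](@big_cat_nat _ _ _ m.+1) //=; last by rewrite ltnS -addnn leq_addr.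
  rewrite [X in _ + X]big1_seq ?addn0 // => i /andP[_].
  rewrite mem_index_iota => /andP[lt_mi _]; rewrite divn_small //.
  exact: ltn_trans lt_mi (ltn_expl _ (prime_gt1 p_pr)).
rewrite sE; lia.
Qed.

(** Each exact prime power in the coefficient is at most 2m, and so is each of its primes. *)
Lemma bin_central_leq_exp m : 0 < m ->
  'C(m.*2, m) <= m.*2 ^ size (primes_in 0 m.*2).
Proof.
move=> m_gt0; rewrite -[leqLHS]prod_primes_logn ?bin_central_gt0 //.
apply: (@leq_trans (m.*2 ^ size (primes 'C(m.*2, m)))).
  elim: (primes _) (all_prime_primes 'C(m.*2, m)) => [|p s IHs] /=.
    by rewrite big_nil.
  by move=> /andP[p_pr ps]; rewrite big_cons expnS leq_mul ?IHs ?logn_bin_central.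
rewrite leq_pexp2l ?double_gt0 // uniq_leq_size ?primes_uniq // => p.
rewrite mem_primes mem_primes_in => /and3P[p_pr _ p_dvd].
rewrite p_pr prime_gt0 //=; apply: leq_trans (logn_bin_central p_pr m_gt0).
rewrite -{1}[p]expn1 leq_exp2l ?prime_gt1 // logn_gt0 mem_primes p_pr p_dvd.
by rewrite bin_central_gt0.
Qed.

(** With m = 2^k and s primes up to 2m, 4^m <= (2m+1) (2m)^s and 2m+1 <= 2^(k+2). Comparing
    exponents of 2 gives 2^(k+1) <= (k+2) + (k+1)s, and k+2 <= 2(k+1). *)
Lemma chebyshev_lower k : 2 ^ k.+1 <= k.+1 * (size (primes_in 0 (2 ^ k.+1)) + 2).
Proof.
have k_gt0 : 0 < 2 ^ k by rewrite expn_gt0.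
have := leq_trans (leq_exp4_bin_central (2 ^ k))
  (leq_mul (leqnn _) (bin_central_leq_exp k_gt0)).
rewrite -mul2n -expnS; set s := size _ => le1.
have : 4 ^ 2 ^ k <= 2 ^ k.+2 * 2 ^ (k.+1 * s).
  apply: leq_trans le1 _; rewrite -expnM leq_mul2r; apply/orP; right.
  rewrite [leqRHS]expnS mul2n -addnn -[leqLHS]addn1 leq_add2l.
  by rewrite expn_gt0.
rewrite -[4]/(2 ^ 2) -expnM -expnS -expnD leq_exp2l //; lia.
Qed.

(** With m = 2^k, the primes in (m, 2m] divide (2m)! but not m!, so their product divides the
    central coefficient, which is at most 4^m. Each of them exceeds 2^k. *)
Lemma chebyshev_upper k : k * size (primes_in (2 ^ k) (2 ^ k.+1)) <= 2 ^ k.+1.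
Proof.
set s := primes_in _ _; set m := 2 ^ k.
have : 2 ^ (k * size s) <= 4 ^ m.
  apply: (@leq_trans 'C(m.*2, m)); last exact: bin_central_leq.
  apply: leq_trans (dvdn_leq (bin_central_gt0 m) _).
    rewrite expnM; apply: expn_size_leq_prod => p.
    by rewrite mem_primes_in => /and3P[_ /ltnW].
  apply: prod_primes_dvdn; rewrite ?primes_in_uniq ?all_prime_primes_in //.
  move=> p; rewrite mem_primes_in expnS mul2n => /and3P[p_pr lt_p le_p].
  have: p %| m.*2`! by rewrite dvdn_fact // prime_gt0.
  rewrite -(@bin_fact m.*2 m); last by rewrite -addnn leq_addr.
  have -> : m.*2 - m = m by rewrite -addnn addnK.
  rewrite !Euclid_dvdM // orbb.
  have nd : ~~ (p %| m`!).
    have := logn_fact m p_pr; rewrite big1_seq.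
      move/eqP; rewrite -leqn0 leqNgt logn_gt0 mem_primes fact_gt0 /=.
      by rewrite p_pr.
    move=> i /andP[_]; rewrite mem_index_iota => /andP[i_gt0 _].
    rewrite divn_small // (leq_trans lt_p) //.
    by rewrite -{1}[p]expn1 leq_exp2l ?prime_gt1.
  by rewrite (negPf nd) orbF.
by rewrite -[4]/(2 ^ 2) -expnM leq_exp2l // -expnS.
Qed.

(** * Prime divisors of Mersenne numbers *)

Lemma prime_dvd_mersenne p q :
  prime p -> prime q -> q %| 2 ^ p - 1 -> p < q.
Proof.
move=> p_pr q_pr q_dvd; rewrite ltnNge; apply/negP => le_qp.
(* If q <= p then p and q - 1 are coprime, so both 2^p = 1 and 2^(q-1) = 1 mod q
   give 2 = 1 mod q. *)
have p_gt0 := prime_gt0 p_pr; have q_gt1 := prime_gt1 q_pr.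
have co_2q : coprime 2 q.
  rewrite prime_coprime // dvdn_prime2 //; apply/eqP => q2.
  have : ~~ odd (2 ^ p - 1) by rewrite -dvdn2 {1}q2.
  by rewrite oddB ?expn_gt0 // oddX gtn_eqF.
have pE : 2 ^ p = 1 %[mod q].
  by apply/eqP; rewrite eqn_mod_dvd ?expn_gt0.
have qE : 2 ^ q.-1 = 1 %[mod q].
  by rewrite -(Euler_exp_totient co_2q) totient_prime.
have [a _] := Bezoutl q.-1 p_gt0.
have /eqP -> : coprime p q.-1.
  by rewrite prime_coprime // gtnNdvd //;
    case: q q_gt1 le_qp {q_pr q_dvd co_2q pE qE} => [|[]].
case/dvdnP=> b ab.
have : 2 ^ (1 + a * q.-1) = 2 %[mod q].
  by rewrite expnD mulnC expnM expnAC -modnMml -modnXm qE modnXm exp1n modnMml mul1n.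
rewrite ab expnM expnAC -modnXm pE modnXm exp1n => /eqP.
by rewrite eq_sym eqn_mod_dvd // dvdn1 => /eqP q1; rewrite q1 in q_gt1.
Qed.

(** Every prime factor exceeds p >= 2^s, while their product is below 2^p. *)
Lemma size_primes_mersenne p s :
  prime p -> 2 ^ s <= p -> s * size (primes (2 ^ p - 1)) < p.
Proof.
move=> p_pr le_sp; have m_gt0 : 0 < 2 ^ p - 1.
  by rewrite subn_gt0 -{1}(expn0 2) ltn_exp2l ?prime_gt0.
rewrite -(@ltn_exp2l 2) // expnM.
apply: (@leq_ltn_trans (2 ^ p - 1)); last by rewrite -subn_gt0 subKn ?expn_gt0.
have := prod_primes_dvdn (primes_uniq _) (all_prime_primes (2 ^ p - 1)).
move=> prod_dvd; apply: leq_trans (dvdn_leq m_gt0 (prod_dvd _ _)).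
  apply: expn_size_leq_prod => q; rewrite mem_primes => /and3P[q_pr _ q_dvd].
  exact/(leq_trans le_sp)/ltnW/prime_dvd_mersenne.
by move=> q; rewrite mem_primes => /and3P[].
Qed.

(** * Selecting primes p such that the primes dividing some p - 1 recur *)

(** Greedy deletion: while some q is related to too few entries, drop these entries, at most
    [(t q).-1] of them. Afterwards q is related to nothing, so it never has to be treated again. *)
Lemma subseq_count_geq (A B : eqType) (r : A -> pred B) (t : A -> nat)
    (Q : seq A) (s : seq B) :
  \sum_(q <- Q) (t q).-1 < size s ->
  exists s', [/\ subseq s' s, 0 < size s' &
    {in Q, forall q, has (r q) s' -> t q <= count (r q) s'}].
Proof.
move sQ: (size Q) => m; elim: m Q sQ s => [|m IHm] Q sQ s lt_s.
  exists s; split=> //; first by apply: leq_ltn_trans lt_s.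
  by move/eqP: sQ; rewrite size_eq0 => /eqP -> q.
have [/allP good|] :=
    boolP (all (fun q => has (r q) s ==> (t q <= count (r q) s)) Q).
  exists s; split=> //; first by apply: leq_ltn_trans lt_s.
  by move=> q /good/implyP.
case/allPn=> q0 Qq0; rewrite negb_imply -ltnNge => /andP[_ lt_q0].
have sQ' : size (rem q0 Q) = m by rewrite size_rem // sQ.
have [|s' [sub_s' s'_gt0 good]] := IHm _ sQ' [seq p <- s | ~~ r q0 p].
  rewrite (perm_big _ (perm_to_rem Qq0)) big_cons /= in lt_s.
  rewrite size_filter -(ltn_add2l (count (r q0) s)) (count_predC (r q0) s).
  by apply: leq_ltn_trans lt_s; rewrite leq_add2r -ltnS (ltn_predK lt_q0).
exists s'; split=> //; first exact: subseq_trans sub_s' (filter_subseq _ _).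
(* For [q0] the claim is vacuous: all entries related to it are gone. *)
move=> q Qq; have [-> /hasP[p s'p rp]|ne_q] := eqVneq q q0.
  by have := mem_subseq sub_s' s'p; rewrite mem_filter rp.
by apply: good; rewrite (perm_mem (perm_to_rem Qq0)) inE (negPf ne_q) in Qq.
Qed.

(** The primes up to 2^h are bounded trivially; the powers of 2 from the later blocks form a
    geometric sum. *)
Lemma size_primes_in_dyadic h m i C :
  (forall k, k < i ->
    size (primes_in (2 ^ (h + k)) (2 ^ (h + k).+1)) <= 2 ^ (m + k.+1) + C) ->
  size (primes_in 0 (2 ^ (h + i))) <= 2 ^ h + 2 ^ (m + i.+1) + i * C.
Proof.
elim: i => [_|i IHi le_i].
  by rewrite !addn0 (leq_trans (size_primes_in_leq _ _)) // subn0 leq_addr.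
rewrite (@size_primes_in_cat _ (2 ^ (h + i))) ?leq_exp2l ?leq_add2l //.
have := IHi (fun k lt_k => le_i k (ltnW lt_k)); have := le_i i (leqnn _).
rewrite -addnS !(addnS m i.+1) expnS; lia.
Qed.

(** If all blocks with exponents from h = 2^t to 2h - 1 were poor, there would be at most 2^h +
    2^(2h)/(8h) + hC primes up to 2^(2h), contradicting the lower bound of order 2^(2h)/(2h). *)
Lemma exists_dyadic_many_primes t C : 4 <= t -> C <= 2 ^ t ->
  exists2 k, 2 ^ t <= k < 2 ^ t.+1 &
    2 ^ (k.+1 - (t + 4)) + C < size (primes_in (2 ^ k) (2 ^ k.+1)).
Proof.
move=> t4 leC; set h := 2 ^ t in leC *.
have jh : t + 4 <= h.
  rewrite /h; elim: t t4 {leC h} => // t IHt.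
  rewrite ltnS leq_eqVlt => /predU1P[<- //|/IHt].
  by rewrite expnS; lia.
have h16 : 16 <= h by rewrite -[16]/(2 ^ 4) leq_exp2l.
(* The cubic term absorbs 2h * hC, where C <= h. *)
have hX : 2 * h ^ 3 + 8 * h <= 2 ^ h.
  elim: h h16 {leC jh} => // h IHh; rewrite ltnS leq_eqVlt => /predU1P[<- //|h16].
  have := IHh h16; rewrite [2 ^ h.+1]expnS !expnS !expn0; nia.
have [/hasP[i]|/hasPn few] := boolP (has (fun i =>
    2 ^ ((h + i).+1 - (t + 4)) + C < size (primes_in (2 ^ (h + i)) (2 ^ (h + i).+1)))
    (iota 0 h)).
  rewrite mem_iota => /andP[_ lt_i] many; exists (h + i) => //.
  by rewrite leq_addr /= expnS mul2n -addnn ltn_add2l.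
have h2E : h + h = (h + h).-1.+1 by lia.
have := chebyshev_lower (h + h).-1; rewrite -h2E.
have := @size_primes_in_dyadic h (h - (t + 4)) h C.
have le_few k : k < h -> size (primes_in (2 ^ (h + k)) (2 ^ (h + k).+1)) <=
    2 ^ (h - (t + 4) + k.+1) + C.
  move=> lt_k; have := few k; rewrite mem_iota -leqNgt => /(_ lt_k).
  by congr (_ <= 2 ^ _ + C); lia.
move=> /(_ le_few); set s := size _; set M := 2 ^ (_ + _).
(* The 4 in t + 4 is chosen here: the geometric part, multiplied by 2h, is only a quarter of
   2^(2h). *)
have ME : 8 * (h * M) = 2 ^ h * 2 ^ h.
  rewrite /M /h -[8]/(2 ^ 3) -!expnD; congr (2 ^ _); rewrite -/h; lia.
rewrite expnD; move: hX ME; rewrite !expnS expn0; set X := 2 ^ h; nia.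
Qed.

(** The bound [N * j <= l] makes the sum of 1/p over the whole range O(1/N); the threshold on the
    count will become a lower bound for the exponent of q in the product of the p - 1. *)
Lemma exists_prime_seq N L : exists l j s,
  [/\ N * j <= l, L <= l, uniq s /\ 0 < size s,
      {in s, forall p, prime p && (2 ^ l < p <= 2 ^ (l + j))} &
      forall q, prime q -> has (fun p => q %| p.-1) s ->
        (if q <= N then N.*2 else 2) <= count (fun p => q %| p.-1) s].
Proof.
(* Large enough that k >= 2^t >= 2t^2 forces both N(t+4) <= l and L <= l, where l = k + 1 -
   (t+4). *)
pose t := N + L + 10.
have t2 : 2 * t ^ 2 <= 2 ^ t.
  have : 10 <= t by rewrite leq_addl.
  elim: t => // t IHt; rewrite ltnS leq_eqVlt => /predU1P[<- //|t10].
  by have := IHt t10; rewrite [2 ^ t.+1]expnS !expnS !expn0; nia.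
(* The surplus 2N^2 pays for the deletions caused by primes q <= N: at most N primes, each costing
   less than 2N. *)
have [||k /andP[le_hk lt_k] many] := @exists_dyadic_many_primes t (2 * N ^ 2).
- by rewrite /t; lia.
- by apply: leq_trans t2; rewrite leq_mul2l leq_exp2r // /t; lia.
have le_tk : 2 * (t * t) <= k by apply: leq_trans t2 le_hk.
have le_t : 20 * t <= 2 * (t * t) by rewrite -(mulnA 2 10) !leq_mul // leq_addl.
have le_Nt : N.+1 * (t + 4) <= t * (2 * t) by apply: leq_mul; rewrite /t; lia.
have t10 : N + L + 10 = t by [].
move: t t10 le_tk le_t le_Nt many {le_hk lt_k t2} => t t10 le_tk le_t le_Nt many.
pose l := k.+1 - (t + 4); have lE : l + (t + 4) = k.+1 by rewrite /l; lia.
have l_gt0 : 0 < l by lia.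
pose P := primes_in (2 ^ l) (2 ^ k.+1); pose Q := primes_in 0 (2 ^ k).
pose T q := if q <= N then N.*2 else 2.
have le_Nk : N <= 2 ^ k.
  by apply: leq_trans (ltnW (ltn_expl k (isT : 1 < 2))); lia.
(* A prime q > N costs one deletion, so the total cost is at most pi(2^k) + 2N^2. The rich top block
   keeps [size P] above this even after the loss of at most 2^l primes up to 2^l. *)
have lt_P : \sum_(q <- Q) (T q).-1 < size P.
  have le_l1 : 2 ^ l <= 2 ^ k.+1 by rewrite leq_exp2l //; lia.
  have le_k1 : 2 ^ k <= 2 ^ k.+1 by rewrite leq_exp2l.
  have := size_primes_in_cat (leq0n (2 ^ l)) le_l1.
  have := size_primes_in_cat (leq0n (2 ^ k)) le_k1.
  have := size_primes_in_leq 0 (2 ^ l).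
  suff : \sum_(q <- Q) (T q).-1 <= size Q + 2 * N ^ 2.
    by move: many; rewrite -/l -/P -/Q; lia.
  rewrite /Q (primes_in_cat (leq0n N) le_Nk) big_cat /= size_cat.
  have le1 : \sum_(q <- primes_in 0 N) (T q).-1 <= 2 * N ^ 2.
    apply: (@leq_trans (\sum_(q <- primes_in 0 N) N.*2)).
      rewrite big_seq [leqRHS]big_seq; apply: leq_sum => q.
      by rewrite mem_primes_in /T => /and3P[_ _ ->]; exact: leq_pred.
    rewrite big_const_seq iter_addn_0 count_predT -mul2n -mulnA leq_mul2l.
    by rewrite expnS expn1 leq_mul2l -[leqRHS]subn0 size_primes_in_leq orbT.
  have le2 : \sum_(q <- primes_in N (2 ^ k)) (T q).-1 <= size (primes_in N (2 ^ k)).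
    rewrite -sum1_size big_seq [leqRHS]big_seq.
    apply: leq_sum => q; rewrite mem_primes_in /T => /and3P[_ lt_q _].
    by rewrite [q <= N]leqNgt lt_q.
  lia.
have [s [sub_s s_gt0 good]] := subseq_count_geq (fun q p : nat => q %| p.-1) lt_P.
have memP p : p \in s -> prime p && (2 ^ l < p <= 2 ^ k.+1).
  by move/(mem_subseq sub_s); rewrite mem_primes_in.
exists l, (t + 4), s; rewrite lE; split=> //.
- by move: le_Nt; rewrite mulSn mulnCA; lia.
- by lia.
- by split=> //; apply: subseq_uniq sub_s (primes_in_uniq _ _).
(* It remains to see that q <= 2^k: as p is odd, q divides 2 or (p-1)/2, and p <= 2^(k+1). *)
move=> q q_pr has_q; apply: good => //; rewrite mem_primes_in q_pr prime_gt0 //=.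
case/hasP: has_q => p /memP/and3P[p_pr lt_p le_p] q_dvd.
have p_gt2 : 2 < p by apply: leq_trans lt_p; rewrite ltnS -{1}(expn1 2) leq_exp2l.
have odd_p : odd p by case: (even_prime p_pr) => // p2; rewrite p2 in p_gt2.
have pE : p = (p./2).*2.+1 by rewrite -{1}(odd_double_half p) odd_p.
rewrite pE /= -muln2 Euclid_dvdM // in q_dvd.
case/orP: q_dvd => q_dvd; last first.
  apply: leq_trans (dvdn_leq _ q_dvd) _; rewrite // -{1}(expn1 2) leq_exp2l //.
  by lia.
apply: leq_trans (dvdn_leq _ q_dvd) _; first by rewrite half_gt0 ltnW.
by rewrite -(@leq_pmul2l 2) // -expnS mul2n ltnW // -pE.
Qed.

(** * Arithmetic of the two totients *)

(** On a prime power, p^a - p^(a-1) <= p^a - 1. This deduces the third limit from the first. *)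
Lemma totient_leq_unitary n : totient n <= unitary_totient n.
Proof.
have [->|n_gt0] := posnP n; first by [].
rewrite totientE // /unitary_totient big_seq [leqRHS]big_seq.
apply: leq_prod => p p_n; rewrite -logn_gt0 in p_n.
rewrite -[in leqRHS](prednK p_n) expnS -subn1 mulnBl mul1n leq_sub2l //.
by rewrite expn_gt0; case: p p_n.
Qed.

Lemma unitary_totient_exp2 a : 0 < a -> unitary_totient (2 ^ a) = 2 ^ a - 1.
Proof.
move=> a_gt0.
by rewrite /unitary_totient primesX // primes_prime // big_seq1 pfactorK.
Qed.

Lemma totient_prod_primes (s : seq nat) :
  uniq s -> all prime s -> totient (\prod_(p <- s) p) = \prod_(p <- s) p.-1.
Proof.
elim: s => [|p s IHs] /=; first by rewrite !big_nil.
move=> /andP[psN us] /andP[pp ps]; rewrite !big_cons totient_coprime.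
  by rewrite totient_prime // IHs.
exact: coprime_prod_primes.
Qed.

Lemma count_dvdn_leq_logn (I : Type) (f : I -> nat) (s : seq I) q :
  prime q -> 0 < \prod_(i <- s) f i ->
  count (fun i => q %| f i) s <= logn q (\prod_(i <- s) f i).
Proof.
move=> q_pr; elim: s => [|i s IHs] /=; first by rewrite big_nil logn1.
rewrite big_cons muln_gt0 => /andP[fi_gt0 prod_gt0].
rewrite lognM // leq_add ?IHs //.
by case: (boolP (q %| f i)) => //= q_i; rewrite logn_gt0 mem_primes q_pr fi_gt0.
Qed.

(** Prepares a telescoping bound for the sum of 1/q^v. If q <= N then q^v >= 4^N >= (N+1)^2;
    otherwise q + N < 2q and q^v >= q^2. *)
Lemma leq_mul_expn_threshold N q v : prime q -> (if q <= N then N.*2 else 2) <= v ->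
  (q + N) * (q + N).+1 <= 4 * q ^ v.
Proof.
move=> q_pr; case: (leqP q N) => [le_qN|lt_Nq] le_v.
  have le1 : (2 ^ N) ^ 2 <= q ^ v.
    rewrite -expnM muln2; apply: (@leq_trans (q ^ N.*2)).
      by case: N {le_qN le_v} => // N; rewrite leq_exp2r ?prime_gt1.
    by rewrite leq_exp2l ?prime_gt1.
  have := ltn_expl N (isT : 1 < 2); set X := 2 ^ N in le1 *.
  rewrite !expnS expn0 muln1 in le1 *; nia.
have le1 : q ^ 2 <= q ^ v by rewrite leq_exp2l // prime_gt1.
rewrite !expnS expn0 muln1 in le1 *; nia.
Qed.

Import Order.TTheory GRing.Theory Num.Theory.
Local Open Scope ring_scope.

(** * Lower bounds for the ratios *)

Section Ratios.
Variable R : realFieldType.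

Lemma ler_sum_subset (T : eqType) (s t : seq T) (F : T -> R) :
  uniq s -> {subset s <= t} -> (forall x, 0 <= F x) ->
  \sum_(x <- s) F x <= \sum_(x <- t) F x.
Proof.
move=> + + F_ge0; elim: s t => [|x s IHs] t /=.
  by move=> _ _; rewrite big_nil sumr_ge0.
move=> /andP[xsN us] st; have xt : x \in t by apply: st; rewrite mem_head.
rewrite (perm_big _ (perm_to_rem xt)) !big_cons lerD2l; apply: IHs => // y ys.
have := st y; rewrite inE ys orbT (perm_mem (perm_to_rem xt)) inE => /(_ isT).
by case/predU1P => // yx; rewrite -yx ys in xsN.
Qed.

Lemma ler_sum_size (T : eqType) (s : seq T) (F : T -> R) c :
  {in s, forall x, F x <= c} -> \sum_(x <- s) F x <= (size s)%:R * c.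
Proof.
move=> le_c; rewrite mulr_natl -(count_predT s) -iter_addr_0 -big_const_seq.
by rewrite big_seq [leRHS]big_seq; apply: ler_sum.
Qed.

(** Bernoulli's inequality with distinct terms: (1-x)(1-a) >= 1-x-a for x, a >= 0. *)
Lemma ler_1Bsum_prod (T : eqType) (s : seq T) (F : T -> R) :
  {in s, forall x, 0 <= F x <= 1} ->
  1 - \sum_(x <- s) F x <= \prod_(x <- s) (1 - F x).
Proof.
elim: s => [|x s IHs] F01; first by rewrite !big_nil subr0.
have F01s : {in s, forall y, 0 <= F y <= 1}.
  by move=> y ys; apply: F01; rewrite inE ys orbT.
have := IHs F01s; have /andP[Fx0 Fx1] := F01 x (mem_head _ _).
have : 0 <= \sum_(y <- s) F y.
  by rewrite big_seq sumr_ge0 // => y /F01s /andP[].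
rewrite !big_cons; set a := \sum_(_ <- _) _; set b := \prod_(_ <- _) _.
nra.
Qed.

Lemma prod_pred_geq (T : eqType) (s : seq T) (f : T -> nat) :
  {in s, forall x, (0 < f x)%N} ->
  (\prod_(x <- s) f x)%:R * (1 - \sum_(x <- s) (f x)%:R^-1) <=
    (\prod_(x <- s) (f x - 1))%:R :> R.
Proof.
move=> f_gt0; have -> : (\prod_(x <- s) (f x - 1))%:R =
    (\prod_(x <- s) f x)%:R * \prod_(x <- s) (1 - (f x)%:R^-1) :> R.
  rewrite !natr_prod -big_split /= big_seq [RHS]big_seq.
  apply: eq_bigr => x /f_gt0 fx; rewrite natrB // mulrBr mulr1 divff //.
  by rewrite pnatr_eq0 -lt0n.
rewrite ler_wpM2l ?ler0n //; apply: ler_1Bsum_prod => x /f_gt0 fx.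
by rewrite invr_ge0 ler0n invf_le1 ?ltr0n // ler1n.
Qed.

Lemma unitary_totient_geq n : (0 < n)%N ->
  n%:R * (1 - \sum_(p <- primes n) (p ^ logn p n)%:R^-1) <=
    (unitary_totient n)%:R :> R.
Proof.
move=> n_gt0; rewrite -{1}(prod_primes_logn n_gt0); apply: prod_pred_geq => p.
by rewrite mem_primes expn_gt0 => /andP[/prime_gt0 ->].
Qed.

Lemma totient_geq n : (0 < n)%N ->
  n%:R * (1 - \sum_(p <- primes n) p%:R^-1) <= (totient n)%:R :> R.
Proof.
move=> n_gt0.
have p_gt0 : {in primes n, forall p, (0 < p)%N}.
  by move=> p; rewrite mem_primes => /andP[/prime_gt0].
(* Here n is m times its radical, and the totient changes only the radical, into the product of the
   p - 1. *)
pose m := (\prod_(p <- primes n) p ^ (logn p n).-1)%N.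
have nE : n = (m * \prod_(p <- primes n) p)%N.
  rewrite /m -big_split -{1}(prod_primes_logn n_gt0) /= big_seq [RHS]big_seq.
  by apply: eq_bigr => p; rewrite -logn_gt0 -expnSr => /prednK ->.
have -> : totient n = (m * \prod_(p <- primes n) (p - 1))%N.
  rewrite totientE // /m -big_split /=.
  by apply: eq_bigr => p _; rewrite mulnC subn1.
rewrite {1}nE !natrM -mulrA ler_wpM2l ?ler0n //; exact: prod_pred_geq.
Qed.

(** By Chebyshev's upper bound, the block (2^k, 2^(k+1)] contributes at most 2/k <= 2/l. *)
Lemma sum_inv_primes_in l j : (0 < l)%N ->
  \sum_(p <- primes_in (2 ^ l) (2 ^ (l + j))) p%:R^-1 <= (2 * j)%:R / l%:R :> R.
Proof.
move=> l_gt0; elim: j => [|j IHj].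
  have -> : primes_in (2 ^ l) (2 ^ (l + 0)) = [::].
    apply: size0nil; apply/eqP; rewrite -leqn0 addn0.
    by rewrite (leq_trans (size_primes_in_leq _ _)) // subnn.
  by rewrite big_nil mul0r.
rewrite (@primes_in_cat _ (2 ^ (l + j))) ?leq_exp2l ?leq_add2l ?leq_addr //.
rewrite big_cat /= mulnS natrD addrC mulrDl lerD //.
set k := (l + j)%N; rewrite addnS.
have k_gt0 : (0 < k)%N by rewrite /k addn_gt0 l_gt0.
apply: (@le_trans _ _ (2 / k%:R)); last first.
  by rewrite ler_pM2l // lef_pV2 ?posrE ?ltr0n // ler_nat leq_addr.
apply: (@le_trans _ _ ((size (primes_in (2 ^ k) (2 ^ k.+1)))%:R / (2 ^ k)%:R)).
  apply: ler_sum_size => p; rewrite mem_primes_in => /and3P[_ lt_p _].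
  rewrite lef_pV2 ?posrE ?ltr0n ?expn_gt0 // ?ler_nat ?(ltnW lt_p) //.
  exact: leq_ltn_trans lt_p.
rewrite ler_pdivrMr ?ltr0n ?expn_gt0 // mulrAC ler_pdivlMr ?ltr0n //.
by rewrite -!natrM ler_nat mulnC -expnS chebyshev_upper.
Qed.

Lemma sum_inv_prime_power N (s : seq nat) (v : nat -> nat) :
  (0 < N)%N -> uniq s -> all prime s ->
  {in s, forall q, (if q <= N then N.*2 else 2) <= v q}%N ->
  \sum_(q <- s) (q ^ v q)%:R^-1 <= 4 / N%:R :> R.
Proof.
move=> N_gt0 us ps le_v.
(* Telescoping majorant: F q = 1/((q+N)(q+N+1)), and 4 F q dominates the summand. *)
pose F q : R := (q + N)%:R^-1 - (q + N).+1%:R^-1.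
have FE q : F q = ((q + N) * (q + N).+1)%:R^-1.
  have : (q + N)%:R != 0 :> R.
    by rewrite pnatr_eq0 addn_eq0 negb_and -!lt0n N_gt0 orbT.
  have : (q + N)%:R + 1 != 0 :> R by rewrite natr1 pnatr_eq0.
  rewrite /F natrM -natr1; move: (_%:R : R) => a a1_neq0 a_neq0.
  by field; rewrite a1_neq0 a_neq0.
apply: (@le_trans _ _ (\sum_(q <- s) 4 * F q)).
  rewrite big_seq [leRHS]big_seq; apply: ler_sum => q qs.
  have q_pr := allP ps q qs; have q_gt0 := prime_gt0 q_pr.
  rewrite FE ler_pdivlMr ?ltr0n ?muln_gt0 ?addn_gt0 ?q_gt0 //.
  rewrite mulrC ler_pdivrMr ?ltr0n ?expn_gt0 ?q_gt0 //.
  by rewrite -[4]/(4%:R) -natrM ler_nat leq_mul_expn_threshold ?le_v.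
rewrite -mulr_sumr ler_wpM2l //.
(* Extending the sum to all integers below M lets it telescope to at most 1/N. *)
pose M := (\max_(q <- s) q).+1.
apply: (@le_trans _ _ (\sum_(0 <= q < M) F q)).
  apply: ler_sum_subset => // [q qs|q]; last by rewrite FE invr_ge0 ler0n.
  by rewrite mem_index_iota ltnS leq_bigmax_seq.
rewrite (eq_bigr (fun q => (- (q.+1 + N)%:R^-1) - (- (q + N)%:R^-1))); last first.
  by move=> q _; rewrite opprK addrC /F addSn.
rewrite telescope_sumr // opprK add0n addrC lerBlDr lerDl.
by rewrite invr_ge0 ler0n.
Qed.

(** For n = 2^p the loss is in fact at most 2/N: 1/N from the reciprocals of the primes dividing 2^p
    - 1, and 1/N from replacing 2^p - 1 by 2^p. The constant 6 matches the other two ratios. *)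
Lemma exists_totient_unitary_geq N L : (0 < N)%N ->
  exists2 n, (L <= n)%N &
    1 - 6 / N%:R <= (totient (unitary_totient n))%:R / n%:R :> R.
Proof.
move=> N_gt0; have [p lt_p p_pr] := prime_above (2 ^ N + L).
have p_gt0 := prime_gt0 p_pr.
have lt_p2 := ltn_expl p (isT : 1 < 2)%N.
exists (2 ^ p)%N; first by lia.
rewrite unitary_totient_exp2 //; set m := (2 ^ p - 1)%N.
have m_gt0 : (0 < m)%N by rewrite /m; lia.
have NR : 0 < N%:R :> R by rewrite ltr0n.
rewrite ler_pdivlMr ?ltr0n ?expn_gt0 //.
apply: le_trans (totient_geq m_gt0).
have : \sum_(q <- primes m) q%:R^-1 <= N%:R^-1 :> R.
  apply: (@le_trans _ _ ((size (primes m))%:R / p%:R)).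
    apply: ler_sum_size => q; rewrite mem_primes => /and3P[q_pr _ q_dvd].
    rewrite lef_pV2 ?posrE ?ltr0n ?prime_gt0 // ler_nat ltnW //.
    exact: prime_dvd_mersenne.
  rewrite ler_pdivrMr ?ltr0n // mulrC ler_pdivlMr // -natrM ler_nat mulnC ltnW //.
  by apply: size_primes_mersenne; lia.
have : 1 <= N%:R^-1 * (2 ^ p)%:R :> R.
  rewrite mulrC ler_pdivlMr // mul1r ler_nat.
  by have := ltn_expl N (isT : 1 < 2)%N; lia.
rewrite /m natrB ?expn_gt0 //; have : 1 <= (2 ^ p)%:R :> R by rewrite ler1n expn_gt0.
set X := (2 ^ p)%:R; set a := N%:R^-1; set S := \sum_(_ <- _) _.
have : 0 < a by rewrite invr_gt0.
nra.
Qed.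

Lemma exists_unitary_unitary_geq N L : (0 < N)%N ->
  exists2 n, (L <= n)%N &
    1 - 6 / N%:R <= (unitary_totient (unitary_totient n))%:R / n%:R :> R.
Proof.
move=> /(exists_totient_unitary_geq L)[n le_n le_tot]; exists n => //.
apply: le_trans le_tot _; rewrite ler_wpM2r ?invr_ge0 ?ler0n // ler_nat.
exact: totient_leq_unitary.
Qed.

(** Passing from n to m = [totient n] loses 2/N, the sum of 1/p; passing from m to
    [unitary_totient m] loses 4/N, the sum of 1/q^v. Together they give 6/N. *)
Lemma exists_unitary_totient_geq N L : (0 < N)%N ->
  exists2 n, (L <= n)%N &
    1 - 6 / N%:R <= (unitary_totient (totient n))%:R / n%:R :> R.
Proof.
move=> N_gt0.
have [l [j [s [le_Nj le_Ll [us s_gt0] s_in good]]]] := exists_prime_seq N L.+1.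
have l_gt0 : (0 < l)%N by apply: leq_trans le_Ll.
have ps : all prime s by apply/allP => p /s_in /andP[].
pose n := (\prod_(p <- s) p)%N; pose m := totient n.
have mE : m = (\prod_(p <- s) (p - 1))%N.
  by rewrite /m totient_prod_primes //; apply: eq_bigr => p _; rewrite subn1.
have n_gt0 : (0 < n)%N.
  by rewrite /n big_seq prodn_cond_gt0 // => p /(allP ps) /prime_gt0.
have m_gt0 : (0 < m)%N by rewrite totient_gt0.
have NR : 0 < N%:R :> R by rewrite ltr0n.
exists n.
  (* Any p in s divides n and exceeds 2^l > l > L. *)
  have p_s := mem_nth 0%N s_gt0; have /and3P[_ lt_p _] := s_in _ p_s.
  apply: leq_trans (dvdn_leq n_gt0 _); last by rewrite /n (big_rem _ p_s) dvdn_mulr.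
  exact/ltnW/(leq_trans le_Ll)/(leq_trans _ (ltnW lt_p))/ltnW/ltn_expl.
rewrite ler_pdivlMr ?ltr0n //; apply: le_trans (unitary_totient_geq m_gt0).
have le4 : \sum_(q <- primes m) (q ^ logn q m)%:R^-1 <= 4 / N%:R :> R.
  apply: sum_inv_prime_power => //; rewrite ?primes_uniq ?all_prime_primes //.
  move=> q; rewrite mem_primes => /and3P[q_pr _ q_dvd].
  rewrite /m totient_prod_primes // in m_gt0 q_dvd *.
  apply: leq_trans (count_dvdn_leq_logn q_pr m_gt0); apply: good => //.
  by rewrite Euclid_dvd_prod // big_has in q_dvd.
have le2 : \sum_(p <- s) p%:R^-1 <= 2 / N%:R :> R.
  apply: le_trans (ler_sum_subset (t := primes_in (2 ^ l) (2 ^ (l + j))) us _ _) _.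
  - by move=> p /s_in; rewrite mem_primes_in.
  - by move=> p; rewrite invr_ge0 ler0n.
  apply: le_trans (sum_inv_primes_in _ l_gt0) _.
  rewrite ler_pdivrMr ?ltr0n // mulrAC ler_pdivlMr // -!natrM ler_nat.
  by rewrite -mulnA leq_mul2l mulnC le_Nj.
have le_m : n%:R * (1 - \sum_(p <- s) p%:R^-1) <= m%:R :> R.
  by rewrite mE; apply: prod_pred_geq => p /(allP ps) /prime_gt0.
have le_mn : m%:R <= n%:R :> R by rewrite ler_nat totient_leq.
have m_ge0 := ler0n R m; have n_ge0 := ler0n R n.
have a_gt0 : 0 < N%:R^-1 :> R by rewrite invr_gt0.
move: le4 le2 le_m; set S4 := \sum_(q <- primes m) _; set S2 := \sum_(p <- s) _.
move=> le4 le2 le_m; have := ler_wpM2l m_ge0 le4; have := ler_wpM2l n_ge0 le2.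
have := ler_wpM2r (ltW a_gt0) le_mn; nra.
Qed.

End Ratios.

(** * From ratio bounds to upper limits *)

Lemma limn_esup_eq1 (R : realType) (u : nat -> R) (c : R) :
  (forall n, u n <= 1) ->
  (forall N L, (0 < N)%N -> exists2 n, (L <= n)%N & 1 - c / N%:R <= u n) ->
  limn_esup (fun n => (u n)%:E) = 1%:E.
Proof.
move=> u_le1 u_ge; rewrite limn_esup_lim.
apply/eqP; rewrite eq_le; apply/andP; split.
  apply: lime_le; first exact: is_cvg_esups.
  by apply: nearW => L; apply: ge_ereal_sup => _ [n _ <-]; rewrite lee_fin.
apply: lime_ge; first exact: is_cvg_esups.
apply: nearW => L; apply/lee_subgt0Pr => e e_gt0.
(* This makes N > c/e, so c/N < e. *)
pose N := (Num.truncn (c / e)).+1.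
have [n le_Ln le_u] := u_ge N L isT.
apply: (@le_trans _ _ (u n)%:E); last by apply: ereal_sup_ubound; exists n.
rewrite -EFinB lee_fin (le_trans _ le_u) // lerD2l lerN2.
rewrite ler_pdivrMr ?ltr0n // mulrC -ler_pdivrMr //.
by apply/ltW/truncnS_gt.
Qed.

Local Close Scope ring_scope.

Theorem theorem6 (R : realType) :
  [/\ limn_esup (fun n : nat =>
        ((totient (unitary_totient n))%:R / n%:R : R)%R%:E) = (1%R : R)%:E,
      limn_esup (fun n : nat =>
        ((unitary_totient (totient n))%:R / n%:R : R)%R%:E) = (1%R : R)%:E
    & limn_esup (fun n : nat =>
        ((unitary_totient (unitary_totient n))%:R / n%:R : R)%R%:E) = (1%R : R)%:E].
Proof.
have ratio_le1 (f : nat -> nat) (n : nat) :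
    (0 < n -> f n <= n) -> ((f n)%:R / n%:R <= 1 :> R)%R.
  (* At n = 0 the ratio is 0, since the inverse of 0 is 0. *)
  have [->|n_gt0 le_f] := posnP n; first by rewrite invr0 mulr0 ler01.
  by rewrite ler_pdivrMr ?ltr0n // mul1r ler_nat le_f.
split; apply: (@limn_esup_eq1 R _ 6%:R) => [n|N L N_gt0].
- apply: (ratio_le1 (fun n => totient (unitary_totient n))) => n_gt0.
  exact: leq_trans (totient_leq _) (unitary_totient_leq n_gt0).
- exact: exists_totient_unitary_geq.
- apply: (ratio_le1 (fun n => unitary_totient (totient n))) => n_gt0.
  by apply: leq_trans (unitary_totient_leq _) (totient_leq _); rewrite totient_gt0.
- exact: exists_unitary_totient_geq.
- apply: (ratio_le1 (fun n => unitary_totient (unitary_totient n))) => n_gt0.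
  apply: leq_trans (unitary_totient_leq n_gt0).
  exact: unitary_totient_leq (unitary_totient_gt0 _).
- exact: exists_unitary_unitary_geq.
Qed.
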